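(* Let $n\in\{1,2,\dots\}$. a. Assume that $U(\delta)$ is a smooth real-valued function of $\delta\in(n,n+1]$ with $U(n+1)=0$ and $U(\delta)>0$ for $\delta\in(n,n+1)$, and that $$U(\delta)>-U'(\delta)\bigl((\delta-n)\,U(\delta)-(n+1-\delta)\,\delta\bigr),\qquad \delta\in(n,n+1).$$ Then $U(\delta)<u_n(\delta)$ for all $\delta\in(n,n+1)$. b. Assume that $U(\delta)$ is a smooth real-valued function of $\delta\in(n,n+1]$ with $U(n+1)\ge 0$ and $U(\delta)>0$ for $\delta\in(n,n+1)$, and that $$U(\delta)<-U'(\delta)\bigl((\delta-n)\,U(\delta)-(n+1-\delta)\,\delta\bigr),\qquad \delta\in(n,n+1).$$ Then $U(\delta)>u_n(\delta)$ for all $\delta\in(n,n+1)$.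
   Context: For $n\in\{1,2,\dots\}$ and $\delta\in(n,n+1)$, $u_n(\delta)$ denotes the unique positive solution $u$ of $$e^{-u}=1-\frac{u^1}{1!}+\dots+(-1)^{n-1}\frac{u^{n-1}}{(n-1)!}+(-1)^n\frac{\delta u^n}{n!\,(u+\delta)}.$$ ''Smooth on $(n,n+1]$'' means continuously differentiable on $(n,n+1]$ (one-sided at the endpoint $n+1$). *)

(* Defs.v *)
From Stdlib Require Import Factorial Reals ClassicalEpsilon.
Open Scope R_scope.

(* The sum has the n terms k = 0, ..., n-1; it is meant for n >= 1. *)
Definition u_equation (n : nat) (delta u : R) : Prop :=
  exp (- u) =
    sum_f_R0 (fun k => (-1) ^ k * u ^ k / INR (fact k)) (n - 1)
    + (-1) ^ n * (delta * u ^ n / (INR (fact n) * (u + delta))).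

Definition positive_solution (n : nat) (delta u : R) : Prop :=
  0 < u /\ u_equation n delta u.

(* [unique P u] says that P holds at u and at no other point, so u_ is the
   unique positive solution whenever there is one; otherwise its value is
   unspecified. *)
Definition u_ (n : nat) (delta : R) : R :=
  epsilon (inhabits 0) (unique (positive_solution n delta)).

Definition left_open (a b x : R) : Prop := a < x <= b.

(* U is continuously differentiable on D with derivative U'. Both [D_in] and
   [continue_in] take limits inside D, hence are one-sided at an endpoint of an
   interval D that belongs to D; values of U and U' outside D are irrelevant. *)
Definition C1_on (D : R -> Prop) (U U' : R -> R) : Prop :=
  forall x : R, D x -> D_in U U' D x /\ continue_in U' D x.

(* Main.v *)
Require Import Defs.
From Stdlib Require Import Factorial Reals ClassicalEpsilon.
From Stdlib Require Import Ranalysis5 Lra Lia.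
Open Scope R_scope.

(** Write [rho n u] for the remainder [(-1)^n (exp(-u) - sum_{k<n} (-u)^k/k!)],
    which is positive for [u > 0], and [mono n u = u^n/n!]. Since
    [rho n + rho (n+1) = mono n], the equation defining [u_n(delta)] can be
    solved for [delta]: it says [delta = Delta n u] with
    [Delta n u = u * rho n u / rho (n+1) u]. So [u_n] is the inverse function of
    [Delta n], and everything is read off from [Delta n]: it is a decreasing
    bijection from the positive half-line onto [(n, n+1)], tends to [n+1] at [0],
    and, because [rho (n+1)' = rho n], satisfies the Riccati equation
    [u * D' = D (n+1-D) - u (D-n)], whose right-hand side is [ode_rhs n D u].
    Equality in the hypotheses of the theorem is this equation for the inverse
    function. The sign of [D'] is the delicate point ([gap_pos]): after
    clearing denominators, an integrating factor turns it into the
    monotonicity of an explicit function that tends to [0] at [0].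

    Given [U], put [phi d = Delta n (U d) - d]; then [U < u_n] iff [phi > 0].
    By the Riccati equation [phi' = U' * ode_rhs n (Delta n U) U / U - 1], while
    the hypothesis compares [U' * ode_rhs n d U] with [U].

    - Part a. Where [phi <= 0], that is [Delta n U <= d], the function [ode_rhs]
      being decreasing in its first argument makes [phi' < 0]: if [U' <= 0]
      through the hypothesis, and if [U' >= 0] because
      [ode_rhs n (Delta n U) U < 0]. So once [phi <= 0] it decreases strictly
      and cannot come back to its value [0] at [n+1].

    - Part b. The hypothesis forces [ode_rhs n d (U d)] to be nonzero. If it
      were positive at some [d], it would remain so up to [n+1] and [U] would
      increase there; but [ode_rhs n d U > 0] says [U < d (n+1-d) / (d-n)], which
      tends to [0]. So it is negative everywhere, hence so is [U'],
      and [phi >= 0] implies [phi' > 0], which is incompatible with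
      [phi (n+1) <= 0].

    In both parts the conclusion is drawn by minimizing [phi] or [- phi] on
    [[d, n+1]] ([pos_of_downward_crossings]). *)

(** * Derivatives and monotonicity *)

Lemma derivable_pt_lim_eq (f : R -> R) (x l l' : R) :
  derivable_pt_lim f x l -> l = l' -> derivable_pt_lim f x l'.
Proof. now intros H <-. Qed.

Lemma increasing_of_deriv (f f' : R -> R) (a b : R) :
  a < b ->
  (forall x, a <= x <= b -> derivable_pt_lim f x (f' x)) ->
  (forall x, a < x < b -> 0 < f' x) ->
  f a < f b.
Proof.
  intros Hab Hd Hpos.
  destruct (MVT_cor2 f f' a b Hab Hd) as (c & Hc & Hin).
  assert (0 < f' c * (b - a)) by (apply Rmult_lt_0_compat; [auto | lra]).
  lra.
Qed.

Lemma lt_right_of_neg_deriv (f : R -> R) (x l b : R) :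
  derivable_pt_lim f x l -> l < 0 -> x < b ->
  exists y, x < y < b /\ f y < f x.
Proof.
  intros Hd Hl Hb.
  destruct (Hd (- l)) as (eta & Heta); [lra |].
  pose proof (cond_pos eta) as Hpos.
  pose (h := Rmin (eta / 2) ((b - x) / 2)).
  assert (Hh : 0 < h) by (apply Rmin_glb_lt; lra).
  assert (h <= eta / 2) by apply Rmin_l.
  assert (h <= (b - x) / 2) by apply Rmin_r.
  exists (x + h); split; [lra |].
  specialize (Heta h).
  assert (Hq : Rabs ((f (x + h) - f x) / h - l) < - l).
  { apply Heta; [lra |]. rewrite Rabs_pos_eq; lra. }
  apply Rabs_def2 in Hq.
  assert (Hneg : (f (x + h) - f x) / h < 0) by lra.
  assert (f (x + h) - f x = (f (x + h) - f x) / h * h) by (field; lra).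
  nra.
Qed.

(** * The remainders of the exponential series *)

Definition mono (n : nat) (u : R) : R := u ^ n / INR (fact n).

Lemma mono_pos (n : nat) (u : R) : 0 < u -> 0 < mono n u.
Proof.
  intros Hu. apply Rdiv_lt_0_compat.
  - now apply pow_lt.
  - apply INR_fact_lt_0.
Qed.

Lemma mono_succ (n : nat) (u : R) : INR (S n) * mono (S n) u = u * mono n u.
Proof.
  unfold mono. rewrite fact_simpl, mult_INR. simpl pow.
  field. split; [apply INR_fact_neq_0 | now apply not_0_INR].
Qed.

Lemma mono_deriv (n : nat) (u : R) :
  derivable_pt_lim (mono (S n)) u (mono n u).
Proof.
  unfold mono.
  apply (derivable_pt_lim_eq (fun x => x ^ S n * (fct_cte (/ INR (fact (S n)))) x) u
              (INR (S n) * u ^ pred (S n) * fct_cte (/ INR (fact (S n))) u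
               + u ^ S n * 0)).
  - apply (derivable_pt_lim_mult (fun x => x ^ S n)).
    + apply derivable_pt_lim_pow.
    + apply derivable_pt_lim_const.
  - unfold fct_cte. rewrite fact_simpl, mult_INR. simpl pred.
    field. split; [apply INR_fact_neq_0 | now apply not_0_INR].
Qed.

(** Building [rho n + rho (S n) = mono n] into the definition makes [rho_deriv] an
    immediate induction; [rho_partial_sum] recovers the closed form. *)
Fixpoint rho (n : nat) (u : R) : R :=
  match n with
  | O => exp (- u)
  | S m => mono m u - rho m u
  end.

Lemma rho_succ (n : nat) (u : R) : rho (S n) u = mono n u - rho n u.
Proof. reflexivity. Qed.

Lemma rho_partial_sum (n : nat) (u : R) :
  rho (S n) u = (-1) ^ S n
    * (exp (- u) - sum_f_R0 (fun k => (-1) ^ k * u ^ k / INR (fact k)) n).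
Proof.
  induction n as [| n IH].
  - simpl. unfold mono. simpl. field.
  - rewrite rho_succ, IH, tech5.
    assert (Hsq : (-1) ^ S n * (-1) ^ S n = 1).
    { rewrite <- Rpow_mult_distr. replace (-1 * -1) with 1 by ring. apply pow1. }
    replace ((-1) ^ S (S n)) with (- (-1) ^ S n) by (simpl; ring).
    unfold mono, Rdiv.
    set (e := (-1) ^ S n) in *.
    set (t := u ^ S n * / INR (fact (S n))).
    replace (e * u ^ S n * / INR (fact (S n))) with (e * t) by (unfold t; ring).
    set (S' := sum_f_R0 _ n).
    replace t with (e * e * t) at 1 by (rewrite Hsq; ring).
    ring.
Qed.

Lemma rho_deriv (n : nat) (u : R) : derivable_pt_lim (rho (S n)) u (rho n u).
Proof.
  induction n as [| n IH].
  - (* [1 / 1] is what [mono 0] computes to. *)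
    apply (derivable_pt_lim_eq
        (fct_cte (1 / 1) - comp exp (- id))%F u
        (0 - exp ((- id)%F u) * (- (1)))).
    + apply derivable_pt_lim_minus; [apply derivable_pt_lim_const |].
      apply derivable_pt_lim_comp.
      * apply derivable_pt_lim_opp, derivable_pt_lim_id.
      * apply derivable_pt_lim_exp.
    + unfold opp_fct, id. simpl. ring.
  - change (derivable_pt_lim (mono (S n) - rho (S n))%F u
              (mono n u - rho n u)).
    apply derivable_pt_lim_minus; [apply mono_deriv | exact IH].
Qed.

Lemma rho_succ_0 (n : nat) : rho (S n) 0 = 0.
Proof.
  induction n as [| n IH].
  - simpl. unfold mono. simpl. rewrite Ropp_0, exp_0. field.
  - rewrite rho_succ, IH. unfold mono. simpl pow. unfold Rdiv. ring.
Qed.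

(** From [rho 1] on, each remainder vanishes at [0] and has the previous one as
    derivative, so positivity passes up from [exp (- u)]. *)
Lemma rho_pos (n : nat) (u : R) : 0 < u -> 0 < rho n u.
Proof.
  revert u. induction n as [| n IH]; intros u Hu.
  - apply exp_pos.
  - rewrite <- (rho_succ_0 n).
    apply (increasing_of_deriv (rho (S n)) (rho n)); [assumption | |].
    + intros x _. apply rho_deriv.
    + intros x Hx. apply IH. lra.
Qed.

Lemma exp_mult_deriv (f : R -> R) (x l : R) :
  derivable_pt_lim f x l ->
  derivable_pt_lim (fun y => exp y * f y) x (exp x * (f x + l)).
Proof.
  intros Hf. eapply derivable_pt_lim_eq.
  - apply (derivable_pt_lim_mult exp f); [apply derivable_pt_lim_exp | exact Hf].
  - ring.
Qed.

(** * Positivity of two combinations of remainders *)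

(** For [u > 0], [excess n u] is [(Delta n u - n) * rho (S n) u], and
    [excess (S n) u] is [(n + 1 - Delta n u) * rho (S n) u]: its positivity, for
    [n] and for [S n], locates [Delta n u] between [n] and [n + 1]. *)
Definition excess (n : nat) (u : R) : R := u * rho n u - INR n * rho (S n) u.

Lemma excess_0 (n : nat) : excess n 0 = 0.
Proof. unfold excess. rewrite rho_succ_0. ring. Qed.

Lemma excess_deriv (n : nat) (u : R) : (1 <= n)%nat ->
  derivable_pt_lim (excess n) u (rho n u - excess n u).
Proof.
  intros Hn. destruct n as [| m]; [lia |].
  apply (derivable_pt_lim_eq
      (id * rho (S m) - mult_real_fct (INR (S m)) (rho (S (S m))))%F u
      (1 * rho (S m) u + id u * rho m u - INR (S m) * rho (S m) u)).
  - apply derivable_pt_lim_minus.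
    + apply derivable_pt_lim_mult; [apply derivable_pt_lim_id | apply rho_deriv].
    + apply derivable_pt_lim_scal, rho_deriv.
  - unfold excess, id. rewrite (rho_succ (S m)).
    pose proof (mono_succ m u) as Hs.
    pose proof (rho_succ m u) as Hr. nra.
Qed.

(** The linear equation [w' = rho n - w] says [(exp * w)' = exp * rho n > 0]. *)
Lemma excess_pos (n : nat) (u : R) : (1 <= n)%nat -> 0 < u -> 0 < excess n u.
Proof.
  intros Hn Hu.
  assert (H : exp 0 * excess n 0 < exp u * excess n u).
  { apply (increasing_of_deriv (fun y => exp y * excess n y)
             (fun y => exp y * rho n y)); [assumption | |].
    - intros x _. eapply derivable_pt_lim_eq.
      + apply exp_mult_deriv, excess_deriv, Hn.
      + ring.
    - intros x Hx. apply Rmult_lt_0_compat; [apply exp_pos |].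
      apply rho_pos. lra. }
  rewrite excess_0, Rmult_0_r in H.
  pose proof (exp_pos u). nra.
Qed.

(** Up to the factor [- (rho (S n) u)^2 / mono n u], this is the derivative of
    [Delta n]. With this normalization the linear differential equation it satisfies
    has constant coefficient [-1] ([gap_deriv]), hence integrating factor [exp]. *)
Definition gap (n : nat) (u : R) : R :=
  excess n u - rho n u * rho (S n) u / mono n u.

Lemma gap_deriv (n : nat) (u : R) : (1 <= n)%nat -> 0 < u ->
  derivable_pt_lim (gap n) u
    (rho (S n) u * excess n u / (u * mono n u) - gap n u).
Proof.
  intros Hn Hu.
  assert (Hw := excess_deriv n u Hn).
  destruct n as [| m]; [lia |].
  assert (Hs := mono_pos (S m) u Hu).
  apply (derivable_pt_lim_eq
      (excess (S m) - (rho (S m) * rho (S (S m))) / mono (S m))%F u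
      (rho (S m) u - excess (S m) u
       - ((rho m u * rho (S (S m)) u + rho (S m) u * rho (S m) u) * mono (S m) u
          - mono m u * (rho (S m) * rho (S (S m)))%F u) / Rsqr (mono (S m) u))).
  - apply derivable_pt_lim_minus; [exact Hw |].
    apply derivable_pt_lim_div; [| apply mono_deriv | lra].
    apply derivable_pt_lim_mult; apply rho_deriv.
  - assert (Hm : mono m u = INR (S m) * mono (S m) u / u).
    { rewrite mono_succ. field. lra. }
    assert (Hr : rho m u = mono m u - rho (S m) u) by (rewrite rho_succ; ring).
    unfold gap, excess, mult_fct, Rsqr.
    rewrite Hr, Hm, (rho_succ (S m)). field. lra.
Qed.

(** By [gap_deriv], [exp * gap n] is strictly increasing; it is bounded below by
    [- exp * rho (S n)], which tends to [0] at [0]. This lower bound dispenses with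
    computing the limit of the quotient in [gap]. *)
Lemma gap_pos (n : nat) (u : R) : (1 <= n)%nat -> 0 < u -> 0 < gap n u.
Proof.
  intros Hn Hu.
  pose (Q := fun y => exp y * gap n y).
  assert (Hincr : forall a b, 0 < a -> a < b -> Q a < Q b).
  { intros a b Ha Hab.
    apply (increasing_of_deriv Q
             (fun y => exp y * (rho (S n) y * excess n y / (y * mono n y))));
      [assumption | |].
    - intros x Hx. eapply derivable_pt_lim_eq.
      + apply exp_mult_deriv, gap_deriv; [exact Hn | lra].
      + ring.
    - intros x Hx. assert (0 < x) by lra.
      apply Rmult_lt_0_compat; [apply exp_pos |].
      apply Rdiv_lt_0_compat; apply Rmult_lt_0_compat;
        auto using rho_pos, excess_pos, mono_pos. }
  assert (Hlow : forall y, 0 < y -> - (exp y * rho (S n) y) < Q y).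
  { intros y Hy. unfold Q, gap.
    pose proof (mono_pos n y Hy). pose proof (rho_pos n y Hy).
    pose proof (rho_pos (S n) y Hy). pose proof (excess_pos n y Hn Hy).
    pose proof (exp_pos y).
    assert (rho n y * rho (S n) y / mono n y < rho (S n) y).
    { apply (Rmult_lt_reg_r (mono n y)); [assumption |].
      unfold Rdiv. rewrite Rmult_assoc, Rinv_l by lra.
      pose proof (rho_succ n y). nra. }
    nra. }
  (* Monotonicity alone gives [Q u >= lim_0 Q >= 0]; comparing with [u / 2]
     makes the inequality strict. *)
  assert (Hhalf : 0 <= Q (u / 2)).
  { destruct (Rle_or_lt 0 (Q (u / 2))) as [H | Hneg]; [exact H | exfalso].
    assert (Hc : continuity_pt (fun y => exp y * rho (S n) y) 0).
    { apply derivable_continuous_pt.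
      eexists. apply exp_mult_deriv, rho_deriv. }
    destruct (Hc (- Q (u / 2))) as (eta & Heta & Hclose); [lra |].
    pose (y := Rmin (eta / 2) (u / 4)).
    assert (0 < y) by (apply Rmin_glb_lt; lra).
    assert (y <= eta / 2) by apply Rmin_l.
    assert (y <= u / 4) by apply Rmin_r.
    specialize (Hclose y). simpl in Hclose. unfold Rdist, D_x, no_cond in Hclose.
    fold (rho (S n)) in Hclose.
    change (mono n y - rho n y) with (rho (S n) y) in Hclose.
    change (mono n 0 - rho n 0) with (rho (S n) 0) in Hclose.
    rewrite rho_succ_0, Rmult_0_r, !Rminus_0_r in Hclose.
    assert (Hb : Rabs (exp y * rho (S n) y) < - Q (u / 2)).
    { apply Hclose. repeat split; [lra |]. rewrite Rabs_pos_eq; lra. }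
    apply Rabs_def2 in Hb.
    pose proof (Hlow y ltac:(lra)).
    pose proof (Hincr y (u / 2) ltac:(lra) ltac:(lra)). lra. }
  pose proof (Hincr (u / 2) u ltac:(lra) ltac:(lra)) as H.
  unfold Q in *. pose proof (exp_pos u). nra.
Qed.

(** * The inverse function of u_n *)

(** For [u > 0] this is [u * rho n u / rho (S n) u] (see [Delta_quotient]). The
    present form takes the limit value [n + 1] at [0], because there the
    numerator [excess (S n)] vanishes and so does its quotient by anything. *)
Definition Delta (n : nat) (u : R) : R :=
  INR n + 1 - excess (S n) u / rho (S n) u.

Lemma Delta_0 (n : nat) : Delta n 0 = INR n + 1.
Proof. unfold Delta. rewrite excess_0. unfold Rdiv. ring. Qed.

Lemma Delta_quotient (n : nat) (u : R) : 0 < u ->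
  Delta n u = u * rho n u / rho (S n) u.
Proof.
  intros Hu. pose proof (rho_pos (S n) u Hu).
  apply (Rmult_eq_reg_r (rho (S n) u)); [| lra].
  unfold Delta, Rdiv. rewrite Rmult_minus_distr_r, !Rmult_assoc, Rinv_l by lra.
  unfold excess. rewrite (rho_succ (S n)).
  pose proof (mono_succ n u). pose proof (rho_succ n u).
  rewrite S_INR in *. nra.
Qed.

Lemma Delta_mult (n : nat) (u : R) : 0 < u ->
  Delta n u * rho (S n) u = u * rho n u.
Proof.
  intros Hu. rewrite Delta_quotient by assumption.
  pose proof (rho_pos (S n) u Hu). field. lra.
Qed.

Lemma Delta_lt (n : nat) (u : R) : 0 < u -> Delta n u < INR n + 1.
Proof.
  intros Hu. unfold Delta.
  assert (0 < excess (S n) u / rho (S n) u); [| lra].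
  apply Rdiv_lt_0_compat; [apply excess_pos; [lia | assumption] | now apply rho_pos].
Qed.

Lemma Delta_gt (n : nat) (u : R) : (1 <= n)%nat -> 0 < u -> INR n < Delta n u.
Proof.
  intros Hn Hu.
  pose proof (excess_pos n u Hn Hu) as He. unfold excess in He.
  pose proof (Delta_mult n u Hu). pose proof (rho_pos (S n) u Hu). nra.
Qed.

(** With [Delta_lt], this squeezes [Delta n] at [0]. *)
Lemma Delta_ge_linear (n : nat) (u : R) : 0 < u -> INR n + 1 - u <= Delta n u.
Proof.
  intros Hu. unfold Delta.
  assert (excess (S n) u / rho (S n) u <= u); [| lra].
  pose proof (rho_pos (S n) u Hu). pose proof (rho_pos (S (S n)) u Hu).
  apply (Rmult_le_reg_r (rho (S n) u)); [assumption |].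
  unfold Rdiv. rewrite Rmult_assoc, Rinv_l by lra.
  unfold excess. pose proof (pos_INR (S n)). nra.
Qed.

(** The Riccati right-hand side: [u * Delta' = ode_rhs n Delta u]. The hypotheses of
    the theorem compare [U d] with [U' d * ode_rhs n d (U d)]. *)
Definition ode_rhs (n : nat) (d u : R) : R := d * (INR n + 1 - d) - u * (d - INR n).

(** Both [rho n] and [excess (S n)] are multiples of [rho (S n)] with
    coefficients rational in [u] and [Delta], so the derivative of the quotient
    closes up in [u] and [Delta] alone. *)
Lemma Delta_deriv (n : nat) (u : R) : 0 < u ->
  derivable_pt_lim (Delta n) u (ode_rhs n (Delta n u) u / u).
Proof.
  intros Hu. pose proof (rho_pos (S n) u Hu) as Hb.
  apply (derivable_pt_lim_eq
      (fct_cte (INR n + 1) - (excess (S n) / rho (S n)))%F u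
      (0 - ((rho (S n) u - excess (S n) u) * rho (S n) u
            - rho n u * excess (S n) u) / Rsqr (rho (S n) u))).
  - apply derivable_pt_lim_minus; [apply derivable_pt_lim_const |].
    apply derivable_pt_lim_div; [apply excess_deriv; lia | apply rho_deriv | lra].
  - pose proof (Delta_mult n u Hu) as Hm.
    assert (He : excess (S n) u = (INR n + 1 - Delta n u) * rho (S n) u).
    { unfold Delta. field. lra. }
    assert (Ha : rho n u = Delta n u * rho (S n) u / u).
    { rewrite Hm. field. lra. }
    rewrite He, Ha. unfold ode_rhs, Rsqr. field. lra.
Qed.

Lemma ode_rhs_Delta_neg (n : nat) (u : R) : (1 <= n)%nat -> 0 < u ->
  ode_rhs n (Delta n u) u < 0.
Proof.
  intros Hn Hu.
  pose proof (rho_pos (S n) u Hu) as Hb.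
  pose proof (mono_pos n u Hu) as Hs.
  pose proof (gap_pos n u Hn Hu) as HK.
  assert (HG : ode_rhs n (Delta n u) u
               = - (u * mono n u * gap n u / (rho (S n) u * rho (S n) u))).
  { rewrite Delta_quotient by assumption. unfold ode_rhs, gap, excess.
    assert (Hr : rho n u = mono n u - rho (S n) u) by (rewrite rho_succ; ring).
    rewrite Hr. field. lra. }
  rewrite HG.
  assert (0 < u * mono n u * gap n u / (rho (S n) u * rho (S n) u)); [| lra].
  apply Rdiv_lt_0_compat; repeat (assumption || apply Rmult_lt_0_compat).
Qed.

Lemma Delta_decreasing (n : nat) (u v : R) : (1 <= n)%nat ->
  0 < u -> u < v -> Delta n v < Delta n u.
Proof.
  intros Hn Hu Huv.
  assert (- Delta n u < - Delta n v); [| lra].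
  apply (increasing_of_deriv (- Delta n)%F
           (fun x => - (ode_rhs n (Delta n x) x / x))); [assumption | |].
  - intros x Hx. apply derivable_pt_lim_opp, Delta_deriv. lra.
  - intros x Hx. assert (0 < x) by lra.
    pose proof (ode_rhs_Delta_neg n x Hn ltac:(lra)).
    replace (- (ode_rhs n (Delta n x) x / x))
      with (- ode_rhs n (Delta n x) x / x) by (field; lra).
    apply Rdiv_lt_0_compat; lra.
Qed.

Lemma lt_of_Delta_lt (n : nat) (u v : R) : (1 <= n)%nat ->
  0 < u -> 0 < v -> Delta n u < Delta n v -> v < u.
Proof.
  intros Hn Hu Hv H.
  destruct (Rtotal_order u v) as [Hlt | [-> | Hgt]]; [| lra | exact Hgt].
  pose proof (Delta_decreasing n u v Hn Hu Hlt). lra.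
Qed.

(** Continuity relative to the half-line is what a nonnegative [U] that may
    vanish at [n + 1] requires. *)
Lemma Delta_continuous (n : nat) (u : R) : 0 <= u ->
  continue_in (Delta n) (fun v => 0 <= v) u.
Proof.
  intros [Hu | <-] eps Heps.
  - destruct (derivable_continuous_pt (Delta n) u
                (exist _ _ (Delta_deriv n u Hu)) eps Heps) as (eta & Heta & Hc).
    exists eta; split; [exact Heta |].
    intros v ((_ & Hv) & Hd). apply Hc. repeat split; assumption.
  - exists eps; split; [exact Heps |].
    intros v ((Hv & Hne) & Hd). simpl in *. unfold Rdist in *.
    rewrite Delta_0. assert (0 < v) by lra.
    pose proof (Delta_lt n v ltac:(lra)).
    pose proof (Delta_ge_linear n v ltac:(lra)).
    rewrite Rminus_0_r, Rabs_pos_eq in Hd by lra.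
    apply Rabs_def1; lra.
Qed.

Lemma Delta_surjective (n : nat) (d : R) : (1 <= n)%nat ->
  INR n < d < INR n + 1 -> exists u, 0 < u /\ Delta n u = d.
Proof.
  intros Hn Hd.
  assert (Hn1 : 1 <= INR n) by (change 1 with (INR 1); now apply le_INR).
  (* [u0] comes from [Delta n u >= n + 1 - u]; [u1] comes from
     [Delta n u < n u / (u - n)] for [u > n], whose right side equals [d] at [u1]. *)
  pose (u0 := (INR n + 1 - d) / 2).
  pose (u1 := INR n * d / (d - INR n)).
  assert (Hu0 : 0 < u0) by (unfold u0; lra).
  assert (Hu1 : u1 * (d - INR n) = INR n * d) by (unfold u1; field; lra).
  assert (Hn1u : INR n < u1) by nra.
  assert (H01 : u0 < u1) by (unfold u0; lra).
  assert (Hu1p : 0 < u1) by lra.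
  assert (Hhi : d < Delta n u0).
  { pose proof (Delta_ge_linear n u0 Hu0). unfold u0 in *. lra. }
  assert (Hlo : Delta n u1 < d).
  { pose proof (Delta_mult n u1 Hu1p) as HD.
    pose proof (rho_pos (S n) u1 Hu1p) as Hb.
    (* This is [rho n < mono (n-1)] multiplied by [u]. *)
    assert (Ha : u1 * rho n u1 < INR n * (rho n u1 + rho (S n) u1)).
    { destruct n as [| m]; [lia |].
      pose proof (rho_pos m u1 Hu1p).
      pose proof (rho_succ m u1). pose proof (rho_succ (S m) u1).
      pose proof (mono_succ m u1). nra. }
    assert (u1 * rho n u1 < d * rho (S n) u1); nra. }
  destruct (IVT_interv (fun u => d - Delta n u) u0 u1) as (z & Hz & Hroot);
    try lra.
  - intros x Hx. apply continuity_pt_minus.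
    + apply continuity_pt_const. now intros ? ?.
    + apply derivable_continuous_pt. eexists. apply Delta_deriv. lra.
  - exists z. split; lra.
Qed.

(** The equation is [rho n u * (u + d) = d * mono n u]; substitute
    [mono n u = rho n u + rho (S n) u] and cancel [d * rho n u]. *)
Lemma u_equation_Delta (n : nat) (d u : R) : (1 <= n)%nat -> 0 < d -> 0 < u ->
  u_equation n d u <-> Delta n u = d.
Proof.
  intros Hn Hd Hu.
  assert (Hr : u_equation n d u <-> rho n u * (u + d) = d * mono n u).
  { destruct n as [| m]; [lia |].
    unfold u_equation. rewrite rho_partial_sum.
    replace (S m - 1)%nat with m by lia.
    assert (Hsq : (-1) ^ S m * (-1) ^ S m = 1).
    { rewrite <- Rpow_mult_distr. replace (-1 * -1) with 1 by ring. apply pow1. }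
    replace (d * u ^ S m / (INR (fact (S m)) * (u + d)))
      with (d * mono (S m) u / (u + d))
      by (unfold mono; field; split; [lra | apply INR_fact_neq_0]).
    set (e := (-1) ^ S m) in *. set (p := sum_f_R0 _ m).
    set (s := mono (S m) u). set (x := exp (- u)).
    split; intros H.
    - rewrite H.
      replace (e * (p + e * (d * s / (u + d)) - p) * (u + d))
        with (e * e * (d * s)) by (field; lra).
      rewrite Hsq. ring.
    - replace (d * s / (u + d)) with (e * (x - p)).
      + rewrite <- Rmult_assoc, Hsq. ring.
      + apply (Rmult_eq_reg_r (u + d)); [| lra].
        rewrite H. field. lra. }
  rewrite Hr.
  pose proof (Delta_mult n u Hu) as HD.
  pose proof (rho_pos (S n) u Hu) as Hb.
  pose proof (rho_succ n u) as Hs.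
  split; intros H.
  - apply (Rmult_eq_reg_r (rho (S n) u)); [| lra]. nra.
  - rewrite H in HD. nra.
Qed.

Lemma u_spec (n : nat) (d : R) : (1 <= n)%nat -> INR n < d < INR n + 1 ->
  0 < u_ n d /\ Delta n (u_ n d) = d.
Proof.
  intros Hn Hd.
  assert (Hd0 : 0 < d) by (pose proof (pos_INR n); lra).
  assert (Hex : exists u, unique (positive_solution n d) u).
  { destruct (Delta_surjective n d Hn Hd) as (u & Hu & HD).
    exists u. split.
    - split; [assumption |]. now apply u_equation_Delta.
    - intros v (Hv & Heq). apply u_equation_Delta in Heq; [| assumption ..].
      destruct (Rtotal_order u v) as [H | [H | H]]; [| exact H |].
      + pose proof (Delta_decreasing n u v Hn Hu H). lra.
      + pose proof (Delta_decreasing n v u Hn Hv H). lra. }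
  destruct (epsilon_spec (inhabits 0) _ Hex) as ((Hu & Heq) & _).
  fold (u_ n d) in Hu, Heq. split; [exact Hu |].
  now apply u_equation_Delta.
Qed.

(** * A comparison principle *)

(** If [f a <= 0 <= f b], the minimum of [f] on [[a, b]] is at most [0] and is
    attained at some point other than [b] (at [a] itself if [b] is a minimizer),
    where [f] takes smaller values further right. *)
Lemma pos_of_downward_crossings (f : R -> R) (a b : R) : a < b ->
  (forall x, a <= x <= b -> continue_in f (fun y => a <= y <= b) x) ->
  0 <= f b ->
  (forall x, a <= x < b -> f x <= 0 -> exists y, x < y < b /\ f y < f x) ->
  0 < f a.
Proof.
  intros Hab Hc Hb Hdown.
  (* Precomposing with the 1-Lipschitz retraction onto [[a, b]] turns relative
     continuity into the two-sided continuity of the extreme value theorem. *)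
  pose (clip := fun x => Rmax a (Rmin x b)).
  assert (Hclip : forall x, a <= x <= b -> clip x = x).
  { intros x Hx. unfold clip. rewrite Rmin_left, Rmax_right; lra. }
  assert (Hin : forall x, a <= clip x <= b).
  { intros x. unfold clip, Rmax, Rmin.
    destruct (Rle_dec x b); destruct (Rle_dec a _); lra. }
  assert (Hlip : forall x y, Rabs (clip x - clip y) <= Rabs (x - y)).
  { intros x y. unfold clip, Rmax, Rmin.
    destruct (Rle_dec x b), (Rle_dec y b); repeat destruct (Rle_dec a _);
      unfold Rabs; repeat destruct (Rcase_abs _); lra. }
  destruct (Rlt_or_le 0 (f a)) as [H | Ha]; [exact H | exfalso].
  destruct (continuity_ab_min (fun x => f (clip x)) a b) as (m & Hmin & Hm);
    [lra | |].
  { intros x Hx eps Heps.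
    destruct (Hc x Hx eps Heps) as (eta & Heta & Hclose).
    exists eta; split; [exact Heta |].
    intros y (_ & Hy). simpl in *. unfold Rdist in *.
    rewrite (Hclip x Hx).
    destruct (Req_dec (clip y) x) as [-> | Hne].
    - now rewrite Rminus_diag, Rabs_R0.
    - apply Hclose. split; [split; [apply Hin | congruence] |].
      rewrite <- (Hclip x Hx). specialize (Hlip y x). lra. }
  assert (Hmin' : forall y, a <= y <= b -> f m <= f y).
  { intros y Hy. specialize (Hmin y Hy). now rewrite !Hclip in Hmin. }
  assert (Hnot : forall x, a <= x < b -> f x <= f m -> False).
  { intros x Hx Hxm.
    assert (Hfx : f x <= 0) by (specialize (Hmin' a); lra).
    destruct (Hdown x Hx Hfx) as (y & Hy & Hlt).
    specialize (Hmin' y). lra. }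
  destruct (Rle_lt_or_eq_dec m b) as [Hlt | ->]; [lra | |].
  - apply (Hnot m); lra.
  - apply (Hnot a); lra.
Qed.

Lemma derivable_of_D_in (U U' : R -> R) (a b x : R) : a < x < b ->
  D_in U U' (left_open a b) x -> derivable_pt_lim U x (U' x).
Proof.
  intros Hx HD eps Heps.
  destruct (HD eps Heps) as (eta & Heta & Hclose).
  assert (Hpos : 0 < Rmin eta (Rmin (x - a) (b - x)))
    by (repeat apply Rmin_glb_lt; lra).
  exists (mkposreal _ Hpos). intros h Hh Hsmall. simpl in *.
  assert (Rmin eta (Rmin (x - a) (b - x)) <= eta) by apply Rmin_l.
  assert (Rmin eta (Rmin (x - a) (b - x)) <= Rmin (x - a) (b - x)) by apply Rmin_r.
  assert (Rmin (x - a) (b - x) <= x - a) by apply Rmin_l.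
  assert (Rmin (x - a) (b - x) <= b - x) by apply Rmin_r.
  specialize (Hclose (x + h)). unfold Rdist, D_x, left_open in Hclose.
  replace (x + h - x) with h in Hclose by ring.
  assert (Hab := Rabs_def2 _ _ Hsmall).
  apply Hclose. repeat split; lra.
Qed.

(** * Sub- and supersolutions of the differential equation *)

Section AlongCurve.

Variables (n : nat) (U U' : R -> R).
Hypothesis hn : (1 <= n)%nat.
Hypothesis U_C1 : C1_on (left_open (INR n) (INR n + 1)) U U'.
Hypothesis U_end : 0 <= U (INR n + 1).
Hypothesis U_pos : forall d, INR n < d < INR n + 1 -> 0 < U d.

Lemma U_deriv (d : R) : INR n < d < INR n + 1 -> derivable_pt_lim U d (U' d).
Proof.
  intros Hd. apply (derivable_of_D_in U U' (INR n) (INR n + 1)); [exact Hd |].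
  apply U_C1. unfold left_open. lra.
Qed.

Definition phi (d : R) : R := Delta n (U d) - d.

Lemma phi_deriv (d : R) : INR n < d < INR n + 1 ->
  derivable_pt_lim phi d (ode_rhs n (Delta n (U d)) (U d) / U d * U' d - 1).
Proof.
  intros Hd.
  apply (derivable_pt_lim_minus (comp (Delta n) U) id).
  - apply derivable_pt_lim_comp; [now apply U_deriv |].
    now apply Delta_deriv, U_pos.
  - apply derivable_pt_lim_id.
Qed.

Lemma phi_continuous (a x : R) : INR n < a -> a <= x <= INR n + 1 ->
  continue_in phi (fun y => a <= y <= INR n + 1) x.
Proof.
  intros Ha Hx eps Heps.
  assert (Hnn : forall y, a <= y <= INR n + 1 -> 0 <= U y).
  { intros y Hy. destruct (Rle_lt_or_eq_dec y (INR n + 1)) as [H | ->];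
      [lra | | exact U_end].
    left. apply U_pos. lra. }
  assert (HUc : continue_in U (left_open (INR n) (INR n + 1)) x).
  { apply (cont_deriv U U'). apply U_C1. unfold left_open. lra. }
  destruct (Delta_continuous n (U x) (Hnn x Hx) (eps / 2)) as (e1 & He1 & H1);
    [lra |].
  destruct (HUc e1 He1) as (e2 & He2 & H2).
  exists (Rmin e2 (eps / 2)); split; [apply Rmin_glb_lt; lra |].
  intros y ((Hy & Hne) & Hd). simpl in *. unfold Rdist in *.
  assert (Rmin e2 (eps / 2) <= e2) by apply Rmin_l.
  assert (Rmin e2 (eps / 2) <= eps / 2) by apply Rmin_r.
  assert (HD : Rabs (Delta n (U y) - Delta n (U x)) < eps / 2).
  { destruct (Req_dec (U x) (U y)) as [Heq | Hneq].
    - rewrite Heq, Rminus_diag, Rabs_R0. lra.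
    - apply H1. split; [split; [now apply Hnn | exact Hneq] |].
      apply H2. unfold D_x, left_open. repeat split; lra. }
  apply Rabs_def2 in HD. apply Rabs_def2 in Hd.
  unfold phi. apply Rabs_def1; lra.
Qed.

(** The difference is [(d' - d) * (d + d' - (n + 1) + u)], and [d + d' > 2 n >= n + 1]. *)
Lemma ode_rhs_decreasing (u d d' : R) : 0 < u -> INR n < d -> d <= d' ->
  ode_rhs n d' u <= ode_rhs n d u.
Proof.
  intros Hu Hd Hdd. unfold ode_rhs.
  assert (1 <= INR n) by (change 1 with (INR 1); now apply le_INR).
  assert (0 <= (d' - d) * (d + d' - (INR n + 1) + u)); [| nra].
  apply Rmult_le_pos; lra.
Qed.

(** Where [phi <= 0], [Delta n (U x) <= x]. The bound
    [U' * ode_rhs n (Delta n U) U < U] follows by monotonicity of [ode_rhs] from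
    the hypothesis if [U' < 0], and from [ode_rhs_Delta_neg] if [U' >= 0]. *)
Lemma below_u :
  U (INR n + 1) = 0 ->
  (forall d, INR n < d < INR n + 1 -> U' d * ode_rhs n d (U d) < U d) ->
  forall d, INR n < d < INR n + 1 -> U d < u_ n d.
Proof.
  intros Hend Hode d Hd.
  assert (Hphi : 0 < phi d).
  { apply (pos_of_downward_crossings phi d (INR n + 1)); [lra | | |].
    - intros x Hx. apply phi_continuous; lra.
    - unfold phi. rewrite Hend, Delta_0. lra.
    - intros x Hx Hle. assert (Hx' : INR n < x < INR n + 1) by lra.
      eapply lt_right_of_neg_deriv; [apply phi_deriv, Hx' | | lra].
      pose proof (U_pos x Hx') as HU.
      pose proof (ode_rhs_Delta_neg n (U x) hn HU) as HG.
      pose proof (Delta_gt n (U x) hn HU) as HDn.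
      unfold phi in Hle.
      pose proof (ode_rhs_decreasing (U x) (Delta n (U x)) x HU HDn ltac:(lra)) as Hmon.
      pose proof (Hode x Hx') as Ho.
      assert (U' x * ode_rhs n (Delta n (U x)) (U x) < U x).
      { destruct (Rle_or_lt 0 (U' x)); nra. }
      apply (Rmult_lt_reg_r (U x)); [exact HU |].
      replace ((ode_rhs n (Delta n (U x)) (U x) / U x * U' x - 1) * U x)
        with (U' x * ode_rhs n (Delta n (U x)) (U x) - U x) by (field; lra).
      lra. }
  destruct (u_spec n d hn Hd) as (Hu & HDu).
  apply (lt_of_Delta_lt n); auto. rewrite HDu. unfold phi in Hphi. lra.
Qed.

(** The hypothesis excludes the value [0], so by the intermediate value theorem a
    positive sign at [d] persists on [[d, n + 1)]. There [U' > 0], so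
    [U x >= U d], whereas [ode_rhs n x (U x) > 0] reads
    [U x * (x - n) < x * (n + 1 - x)], with right side tending to [0]. *)
Lemma ode_rhs_neg_along_U :
  (forall d, INR n < d < INR n + 1 -> U d < U' d * ode_rhs n d (U d)) ->
  forall d, INR n < d < INR n + 1 -> ode_rhs n d (U d) < 0.
Proof.
  intros Hode d Hd.
  assert (Hne : forall x, INR n < x < INR n + 1 -> ode_rhs n x (U x) <> 0).
  { intros x Hx H0. pose proof (Hode x Hx) as H. pose proof (U_pos x Hx).
    rewrite H0 in H. lra. }
  destruct (Rtotal_order (ode_rhs n d (U d)) 0) as [H | [H | Hpos]];
    [exact H | now destruct (Hne d Hd) | exfalso].
  assert (Hstay : forall x, d <= x < INR n + 1 -> 0 < ode_rhs n x (U x)).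
  { intros x Hx.
    destruct (Rtotal_order (ode_rhs n x (U x)) 0) as [H | [H | H]];
      [exfalso | now destruct (Hne x ltac:(lra)) | exact H].
    destruct (Rle_lt_or_eq_dec d x) as [Hlt | <-]; [lra | | lra].
    destruct (IVT_interv (fun y => - ode_rhs n y (U y)) d x) as (z & Hz & Hroot);
      try lra.
    - intros y Hy. unfold ode_rhs.
      assert (HcU : continuity_pt U y).
      { apply derivable_continuous_pt. eexists. apply U_deriv. lra. }
      assert (Hcid : continuity_pt id y) by apply derivable_continuous_pt, derivable_id.
      assert (Hcst : forall c, continuity_pt (fct_cte c) y).
      { intros c. apply continuity_pt_const. now intros ? ?. }
      apply (continuity_pt_opp
        (id * (fct_cte (INR n + 1) - id) - U * (id - fct_cte (INR n)))%F).
      apply continuity_pt_minus; apply continuity_pt_mult; auto;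
        apply continuity_pt_minus; auto.
    - apply (Hne z); lra. }
  pose (m := U d). pose proof (U_pos d Hd) as Hm. fold m in Hm.
  assert (Hgrow : forall x, d <= x < INR n + 1 -> m <= U x).
  { intros x Hx. destruct (Rle_lt_or_eq_dec d x) as [Hlt | <-];
      [lra | | unfold m; lra].
    left. apply (increasing_of_deriv U U'); [exact Hlt | |].
    - intros y Hy. apply U_deriv. lra.
    - intros y Hy. pose proof (Hstay y ltac:(lra)) as HGy.
      pose proof (Hode y ltac:(lra)). pose proof (U_pos y ltac:(lra)). nra. }
  pose proof (pos_INR n) as Hn0.
  (* At distance at most [r] from [n + 1], [m * (x - n) >= (n + 1) * (n + 1 - x)]. *)
  pose (r := m / (INR n + 1 + m)).
  assert (Hr : 0 < r) by (apply Rdiv_lt_0_compat; lra).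
  assert (Hrm : r * (INR n + 1 + m) = m) by (unfold r; field; lra).
  pose (x := Rmax d (INR n + 1 - r)).
  assert (d <= x) by apply Rmax_l.
  assert (INR n + 1 - r <= x) by apply Rmax_r.
  assert (x < INR n + 1) by (apply Rmax_lub_lt; lra).
  pose proof (Hstay x ltac:(lra)) as HGx. pose proof (Hgrow x ltac:(lra)) as HUx.
  unfold ode_rhs in HGx.
  assert (m * (x - INR n) <= U x * (x - INR n)) by (apply Rmult_le_compat_r; lra).
  nra.
Qed.

(** Where [phi >= 0], [Delta n (U x) >= x]; since [U' < 0], monotonicity of
    [ode_rhs] gives [U' * ode_rhs n (Delta n U) U > U], that is [phi' > 0]. *)
Lemma above_u :
  (forall d, INR n < d < INR n + 1 -> U d < U' d * ode_rhs n d (U d)) ->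
  forall d, INR n < d < INR n + 1 -> u_ n d < U d.
Proof.
  intros Hode d Hd.
  pose proof (ode_rhs_neg_along_U Hode) as HGneg.
  assert (Hphi : 0 < - phi d).
  { apply (pos_of_downward_crossings (- phi)%F d (INR n + 1)); [lra | | |].
    - intros x Hx eps Heps.
      destruct (phi_continuous d x ltac:(lra) Hx eps Heps) as (eta & Heta & Hc).
      exists eta; split; [exact Heta |]. intros y Hy. specialize (Hc y Hy).
      simpl in *. unfold Rdist, opp_fct in *.
      rewrite <- Rabs_Ropp.
      now replace (- (- phi y - - phi x)) with (phi y - phi x) by ring.
    - unfold opp_fct, phi. destruct U_end as [H | <-].
      + pose proof (Delta_lt n (U (INR n + 1)) H). lra.
      + rewrite Delta_0. lra.
    - intros x Hx Hle. assert (Hx' : INR n < x < INR n + 1) by lra.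
      eapply lt_right_of_neg_deriv;
        [apply derivable_pt_lim_opp, phi_deriv, Hx' | | lra].
      unfold opp_fct, phi in Hle.
      pose proof (U_pos x Hx') as HU.
      pose proof (ode_rhs_decreasing (U x) x (Delta n (U x)) HU
                    ltac:(lra) ltac:(lra)) as Hmon.
      pose proof (Hode x Hx') as Ho. pose proof (HGneg x Hx') as HGx.
      assert (HU' : U' x < 0) by nra.
      assert (U x < U' x * ode_rhs n (Delta n (U x)) (U x)) by nra.
      apply (Rmult_lt_reg_r (U x)); [exact HU |].
      replace (- (ode_rhs n (Delta n (U x)) (U x) / U x * U' x - 1) * U x)
        with (U x - U' x * ode_rhs n (Delta n (U x)) (U x)) by (field; lra).
      lra. }
  destruct (u_spec n d hn Hd) as (Hu & HDu).
  apply (lt_of_Delta_lt n); auto. rewrite HDu. unfold phi in Hphi. lra.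
Qed.

End AlongCurve.

Theorem proposition16 (n : nat) (hn : (1 <= n)%nat) :
  (forall U U' : R -> R,
      C1_on (left_open (INR n) (INR n + 1)) U U' ->
      U (INR n + 1) = 0 ->
      (forall delta : R, INR n < delta < INR n + 1 -> U delta > 0) ->
      (forall delta : R, INR n < delta < INR n + 1 ->
         U delta > - U' delta * ((delta - INR n) * U delta
                                 - (INR n + 1 - delta) * delta)) ->
      forall delta : R, INR n < delta < INR n + 1 -> U delta < u_ n delta)
  /\
  (forall U U' : R -> R,
      C1_on (left_open (INR n) (INR n + 1)) U U' ->
      U (INR n + 1) >= 0 ->
      (forall delta : R, INR n < delta < INR n + 1 -> U delta > 0) ->
      (forall delta : R, INR n < delta < INR n + 1 ->
         U delta < - U' delta * ((delta - INR n) * U delta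
                                 - (INR n + 1 - delta) * delta)) ->
      forall delta : R, INR n < delta < INR n + 1 -> U delta > u_ n delta).
Proof.
  split; intros U U' HC Hend Hpos Hode.
  - apply (below_u n U U'); auto; [lra |].
    intros d Hd. specialize (Hode d Hd). unfold ode_rhs. lra.
  - apply (above_u n U U'); auto; [lra |].
    intros d Hd. specialize (Hode d Hd). unfold ode_rhs. lra.
Qed.
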